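(* Let $G=(V,E)$ be a finite simple undirected graph with $n=|V|$ even which has a pfaffian orientation, and let $w:E\to[0,\infty)$ be a weight function on the edges. Then $$\operatorname{perfmat} G_w\le \prod_{v\in V}\bigl(d_{w,2}(v)\bigr)^{1/4},\qquad d_{w,2}(v):=\sum_{u:\,(u,v)\in E} w(u,v)^2 .$$ In particular, the number $\operatorname{perfmat} G$ of perfect matchings of $G$ satisfies $$\operatorname{perfmat} G\le\prod_{v\in V} d(v)^{1/4},$$ where $d(v)$ is the degree of $v$ in $G$.
   Context: $\operatorname{perfmat} G$ is the number of perfect matchings of $G$. For a weight function $w:E\to[0,\infty)$, $\operatorname{perfmat} G_w:=\sum_{M}\prod_{e\in M}w(e)$, the sum being over all perfect matchings $M$ of $G$. For an orientation of the edges of $G$, the skew symmetric adjacency matrix is $S(G)=[s_{uv}]_{u,v\in V}$ with $s_{uv}=1$ if the edge $(u,v)\in E$ is oriented from $u$ to $v$, $s_{uv}=-1$ if it is oriented from $v$ to $u$, and $s_{uv}=0$ if $(u,v)\notin E$. An orientation is pfaffian if $\det S(G)=(\operatorname{perfmat} G)^2$. *)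

(* Defs.v *)
From HB Require Import structures.
From mathcomp Require Import all_boot all_order all_algebra.
From mathcomp Require Import reals exp.

Set Implicit Arguments.
Unset Strict Implicit.
Unset Printing Implicit Defensive.

Import Order.TTheory GRing.Theory Num.Theory.

Local Open Scope ring_scope.

(* A finite simple graph is a finite type V of vertices with a symmetric and
   irreflexive adjacency relation e : rel V. *)

Definition edges (V : finType) (e : rel V) : {set {set V}} :=
  [set [set p.1; p.2] | p : V * V & e p.1 p.2].

Definition perfect_matching (V : finType) (e : rel V) (M : {set {set V}}) : bool :=
  (M \subset edges e) && [forall v : V, #|[set x in M | v \in x]| == 1%N].

Definition perfmat (V : finType) (e : rel V) : nat :=
  #|[set M : {set {set V}} | perfect_matching e M]|.

(* A weight function on the edges is a function on all vertex sets, of which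
   only the values on [edges e] are used. *)
Definition wperfmat (R : realType) (V : finType) (e : rel V) (w : {set V} -> R) : R :=
  \sum_(M : {set {set V}} | perfect_matching e M) \prod_(x in M) w x.

Definition wdegree2 (R : realType) (V : finType) (e : rel V) (w : {set V} -> R)
    (v : V) : R :=
  \sum_(u : V | e u v) w [set u; v] ^+ 2.

Definition degree (V : finType) (e : rel V) (v : V) : nat := #|[set u : V | e u v]|.

(* [o u v] means that the edge {u, v} is oriented from u to v. *)
Definition orientation (V : finType) (e o : rel V) : Prop :=
  (forall u v : V, o u v -> e u v) /\
  (forall u v : V, e u v -> o u v (+) o v u).

Definition skew_adjacency (V : finType) (o : rel V) : 'M[int]_#|V| :=
  \matrix_(i, j) (if o (enum_val i) (enum_val j) then 1
                  else if o (enum_val j) (enum_val i) then -1 else 0).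

Definition pfaffian_orientation (V : finType) (e o : rel V) : Prop :=
  orientation e o /\ \det (skew_adjacency o) = (perfmat e)%:Z ^+ 2.

(* Main.v *)
(* Expand the determinant of the weighted skew adjacency matrix over
   permutations.  The permutations with an odd cycle cancel in pairs, by
   reversing one such cycle; those with only even cycles correspond to ordered
   pairs (p, q) of perfect matchings, by following p and q alternately along the
   cycles of their union.  So the determinant is a sum of signed products
   w(p) w(q), where the sign depends only on the orientation.  For w = 1 it is
   (perfmat G)^2, the number of pairs, hence all signs are +1 and the weighted
   determinant is (perfmat G_w)^2.  Hadamard's inequality concludes. *)
Require Import Defs.
From HB Require Import structures.
From mathcomp Require Import all_boot all_order all_fingroup all_algebra.
From mathcomp Require Import reals exp.

Set Implicit Arguments.
Unset Strict Implicit.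
Unset Printing Implicit Defensive.

Import Order.TTheory GRing.Theory Num.Theory.

Local Open Scope ring_scope.

(** * Hadamard's inequality through Gram determinants *)

(* Induction on the number of rows: subtracting from the other rows their
   projections on the first one makes the Gram matrix block diagonal. *)
Lemma det_gram_le (R : realFieldType) (m n : nat) (A : 'M[R]_(m, n)) :
  0 <= \det (A *m A^T) <= \prod_i \sum_j A i j ^+ 2.
Proof.
elim: m A => [|m IHm] A; first by rewrite det_mx00 big_ord0 ler01 lexx.
suff key (a : 'M[R]_(1, n)) (B : 'M_(m, n)) (C := col_mx a B) :
    0 <= \det (C *m C^T) <= \prod_i \sum_j C i j ^+ 2.
  by have := key (@usubmx R 1 m n A) (@dsubmx R 1 m n A); rewrite /= vsubmxK.
rewrite {}/C {A}.
have sqs (k : nat) (C : 'M[R]_(k, n)) i : \sum_j C i j ^+ 2 = (C *m C^T) i i.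
  by rewrite !mxE; apply: eq_bigr => j _; rewrite !mxE expr2.
have sqs_ge0 (k : nat) (C : 'M[R]_(k, n)) i : 0 <= (C *m C^T) i i.
  by rewrite -sqs sumr_ge0 // => j _; rewrite sqr_ge0.
rewrite (@big_split_ord _ _ _ 1 m) /= big_ord1.
have -> : \sum_j col_mx a B (lshift m 0) j ^+ 2 = \sum_j a 0 j ^+ 2.
  by apply: eq_bigr => j _; rewrite col_mxEu.
have -> : \prod_i \sum_j col_mx a B (rshift 1 i) j ^+ 2 =
          \prod_i \sum_j B i j ^+ 2.
  by apply: eq_bigr => i _; apply: eq_bigr => j _; rewrite col_mxEd.
rewrite sqs; set c := (a *m a^T) 0 0.
have aaE : a *m a^T = c%:M by rewrite [LHS]mx11_scalar.
(* If [c] is zero the first row vanishes and both sides are 0; otherwise [c] can be inverted to form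
   the projections. *)
have [c0|c_neq0] := eqVneq c 0.
  have -> : a = 0.
    apply/matrixP => i j; rewrite !mxE ord1; apply/eqP; rewrite -sqrf_eq0.
    move: c0; rewrite /c -sqs => /eqP; rewrite psumr_eq0 => [/allP/(_ j)|k _].
      by rewrite mem_index_enum => /(_ isT).
    exact: sqr_ge0.
  rewrite tr_col_mx mul_col_row trmx0 !mulmx0 !mul0mx.
  by rewrite (@det_ublock R 1 m) det0 ?expr1n mul0r c0 mul0r lexx.
pose B' := B - (c^-1 *: (B *m a^T)) *m a.
have B'a : B' *m a^T = 0.
  by rewrite mulmxBl -mulmxA aaE mul_mx_scalar scalerA divff // scale1r subrr.
have -> : \det (col_mx a B *m (col_mx a B)^T) = c * \det (B' *m B'^T).
  (* [L] adds the projections back and is unitriangular, so it leaves the Gram determinant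
     unchanged. *)
  pose L : 'M[R]_(1 + m) := block_mx 1%:M 0 (c^-1 *: (B *m a^T)) 1%:M.
  have -> : col_mx a B = L *m col_mx a B'.
    by rewrite mul_block_col !mul1mx mul0mx addr0 /B' addrC subrK.
  have L1 : \det L = 1 by rewrite det_lblock !det1 mulr1.
  rewrite trmx_mul mulmxA -[L *m _ *m _]mulmxA !det_mulmx det_tr L1 mulr1 mul1r.
  rewrite tr_col_mx mul_col_row B'a aaE det_ublock det_scalar1 //.
have /andP[D0 Dle] := IHm B'.
have c_ge0 : 0 <= c by exact: sqs_ge0.
rewrite mulr_ge0 //= ler_wpM2l //; apply: (le_trans Dle).
apply: ler_prod => i _; rewrite !sqs sqs_ge0 /=.
(* Pythagoras: the rows of [B'] are orthogonal to [a], so the cross terms vanish, and passing from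
   [B'] to [B] only adds the nonnegative diagonal of a Gram matrix. *)
have -> : B = B' + (c^-1 *: (B *m a^T)) *m a by rewrite subrK.
move: (c^-1 *: _) => u; clearbody B'.
rewrite linearD /= mulmxDl !mulmxDr trmx_mul [B' *m (_ *m _)]mulmxA B'a mul0mx addr0.
have -> : u *m a *m B'^T = 0.
  by rewrite -mulmxA -[a *m _]trmxK trmx_mul trmxK B'a trmx0 mulmx0.
by rewrite add0r -trmx_mul [leRHS]mxE lerDl sqs_ge0.
Qed.

Lemma hadamard_sqr (R : realFieldType) (n : nat) (A : 'M[R]_n) :
  (\det A) ^+ 2 <= \prod_i \sum_j A i j ^+ 2.
Proof.
by have /andP[_] := det_gram_le A; rewrite det_mulmx det_tr -expr2.
Qed.

(** * Two-colorings of permutation cycles and of unions of two matchings *)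

Definition two_coloring (T : finType) (g : rel T) (A : {set T}) :=
  [forall x, forall y, g x y ==> ((y \in A) == (x \notin A))].

Definition bipartite (T : finType) (g : rel T) := [exists A, two_coloring g A].

(* The choice depends on the edge relation only, so that [alternate] and
   [unalternate] below use the same coloring. *)
Definition coloring (T : finType) (g : rel T) : {set T} :=
  odflt set0 [pick A | two_coloring g A].

Lemma coloringP (T : finType) (g : rel T) (x y : T) :
  bipartite g -> g x y -> (y \in coloring g) = (x \notin coloring g).
Proof.
rewrite /coloring => /existsP[A0 colA0] gxy.
case: pickP => [A|/(_ A0)]; last by rewrite colA0.
by move=> /forallP/(_ x)/forallP/(_ y)/implyP/(_ gxy)/eqP.
Qed.

Lemma eq_coloring (T : finType) (g g' : rel T) :
  g =2 g' -> coloring g = coloring g'.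
Proof.
move=> gg'; rewrite /coloring; congr odflt; apply: eq_pick => A.
by apply: eq_forallb => x; apply: eq_forallb => y; rewrite gg'.
Qed.

Lemma eq_bipartite (T : finType) (g g' : rel T) :
  g =2 g' -> bipartite g = bipartite g'.
Proof.
move=> gg'; apply: eq_existsb => A.
by apply: eq_forallb => x; apply: eq_forallb => y; rewrite gg'.
Qed.

Definition cycle_graph (T : finType) (s : {perm T}) : rel T :=
  [rel x y | (y == s x) || (x == s y)].

Definition pair_graph (T : finType) (p q : {ffun T -> T}) : rel T :=
  [rel x y | (y == p x) || (y == q x)].

Lemma dvdn_card_porbit (T : finType) (s : {perm T}) (x : T) (k : nat) :
  (s ^+ k)%g x = x -> (#|porbit s x| %| k)%N.
Proof.
move=> skx; have d_gt0 : (0 < #|porbit s x|)%N by rewrite lt0n card_porbit_neq0.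
rewrite /dvdn; apply/negPn/negP => r_neq0.
have rx : iter (k %% #|porbit s x|) s x = x.
  rewrite -permX; move: skx; rewrite {1}(divn_eq k #|porbit s x|) expgD permM.
  rewrite mulnC expgM; set t := (s ^+ #|porbit s x|)%g.
  have tx : t x = x by rewrite permX iter_porbit.
  have -> : (t ^+ (k %/ #|porbit s x|))%g x = x.
    by rewrite permX; elim: (k %/ _)%N => //= j ->.
  by [].
have := nth_uniq x _ _ (uniq_traject_porbit s x).
move=> /(_ (k %% #|porbit s x|)%N 0%N); rewrite size_traject ltn_mod d_gt0.
rewrite !nth_traject ?ltn_mod // rx /= eqxx => /(_ isT isT).
by rewrite (negPf r_neq0).
Qed.

(** An even cycle of [s] splits into two orbits of [s ^+ 2], which [s] exchanges. The color class
    takes, in each cycle, the one containing the representative [m x], common to all points of the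
    cycle. *)
Lemma bipartite_cycle_graph (T : finType) (s : {perm T}) :
  (forall x, ~~ odd #|porbit s x|) -> bipartite (cycle_graph s).
Proof.
move=> s_even; pose m x := odflt x [pick y in porbit s x].
have m_orb x : x \in porbit s (m x).
  rewrite /m porbit_sym; case: pickP => [y //|/(_ x)].
  by rewrite porbit_id.
have mE x y : x \in porbit s y -> m x = m y.
  rewrite -eq_porbit_mem /m => /eqP ->; case: pickP => [//|/(_ y)].
  by rewrite porbit_id.
have mS x : m (s x) = m x by apply: mE; exact: (mem_porbit s 1 x).
pose A := [set x | x \in porbit (s ^+ 2)%g (m x)].
have colA x : (s x \in A) = (x \notin A).
  rewrite !inE mS; have [] := boolP (x \in porbit (s ^+ 2)%g (m x)).
    move=> xA; apply/negP => sxA.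
    (* If [x] and [s x] shared an orbit of [s ^+ 2], an odd power of [s] would fix [x], which an
       orbit of even size forbids. *)
    have := sxA; rewrite -eq_porbit_mem => /eqP E; move: xA; rewrite -E.
    move=> /porbitP[k]; rewrite -expgM -permM -expgS => /esym/dvdn_card_porbit.
    move: (s_even x); rewrite -dvdn2 => d2 /(dvdn_trans d2).
    by rewrite dvdn2 /= oddM.
  have /porbitP[k xk] := m_orb x; rewrite {1 3}xk => xA.
  have k_odd : odd k.
    apply/negPn/negP => k_even; move/negP: xA; apply.
    by rewrite -[k]odd_double_half (negPf k_even) add0n -mul2n expgM mem_porbit.
  rewrite -permM -expgSr -[k.+1]odd_double_half /= k_odd add0n -mul2n expgM.
  by rewrite mem_porbit.
apply/existsP; exists A; apply/forallP => x; apply/forallP => y; apply/implyP.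
by move=> /orP[] /eqP->; rewrite colA ?negbK.
Qed.

(** The components are cycles alternating between [p] and [q], possibly of length two. Since [r]
    advances by two edges, each component consists of two [r]-orbits, exchanged by both [p] and [q];
    the color class takes the orbit of the root. *)
Lemma bipartite_pair_graph (T : finType) (p q : {ffun T -> T}) :
  involutive p -> involutive q -> (forall x, p x != x) -> (forall x, q x != x) ->
  bipartite (pair_graph p q).
Proof.
move=> pK qK p_fix q_fix; pose r x := q (p x).
have r_inj : injective r by move=> x y /(inv_inj qK)/(inv_inj pK).
(* p conjugates r into its inverse, so p x = r^k x yields a fixed point of p
   or of q according to the parity of k. *)
have r_fconn k x : iter k r x != p x.
  elim/ltn_ind: k x => -[_|[_|k IHk]] x; rewrite ?q_fix //=.
    by rewrite eq_sym p_fix.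
  apply/eqP => /= E; have /eqP := IHk k (ltnW (leqnn _)) (r x); apply.
  apply: (inv_inj pK); rewrite pK -iterSr; apply: (inv_inj qK).
  by rewrite [RHS]qK -E.
set g := pair_graph p q.
have g_sym : connect_sym g.
  apply: sym_connect_sym => x y; rewrite /g /= /pair_graph /=.
  by congr (_ || _); rewrite eq_sym ?(can2_eq pK pK) ?(can2_eq qK qK).
pose A := [set x | fconnect r (fingraph.root g x) x].
have rootE x y : g x y -> fingraph.root g x = fingraph.root g y.
  by move=> gxy; apply/eqP; rewrite (root_connect g_sym) connect1.
have gp x : g x (p x) by apply/orP; left.
have gq x : g x (q x) by apply/orP; right.
have rV x m : fconnect r m x = fconnect r m (r x) by rewrite (same_fconnect1_r r_inj).
(* The points in the [r]-orbit of [m], or sent into it by [p], form a set closed under [p] and [q],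
   so they fill the component. *)
have cover x m : connect g m x -> fconnect r m x || fconnect r m (p x).
  pose S := [pred x | fconnect r m x || fconnect r m (p x)].
  have S_closed : closed g S.
    apply: intro_closed => // {}x y /orP[] /eqP-> /orP[] mx; rewrite inE.
    - by rewrite pK mx orbT.
    - by rewrite mx.
    - by rewrite [X in _ || X]rV [r (p _)]/r pK qK mx orbT.
    - suff -> : q x = r (p x) by rewrite -rV mx.
      by rewrite /r pK.
  by move=> /(closed_connect S_closed); rewrite !inE connect0 => <-.
have colp x : (p x \in A) = (x \notin A).
  rewrite !inE -(rootE _ _ (gp x)); set m := fingraph.root g x.
  have := cover x m; rewrite g_sym connect_root => /(_ isT).
  have [mx _|//] := boolP (fconnect r m x).
  apply/negP => mpx; have : fconnect r x (p x).
    by apply: connect_trans mpx; rewrite fconnect_sym.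
  by move=> /iter_findex/eqP; rewrite (negPf (r_fconn _ _)).
have colq x : (q x \in A) = (x \notin A).
  rewrite -colp !inE -(rootE _ _ (gp x)) -(rootE _ _ (gq x)).
  suff -> : q x = r (p x) by rewrite -rV.
  by rewrite /r pK.
apply/existsP; exists A; apply/forallP => x; apply/forallP => y; apply/implyP.
by move=> /orP[] /eqP->; rewrite ?colp ?colq.
Qed.

(** * Reversing an odd cycle *)

(* The choice depends on the set of orbits only, which reversing an orbit
   preserves; hence [rev_odd_orbit] is an involution. *)
Definition odd_orbit (T : finType) (s : {perm T}) : {set T} :=
  odflt set0 [pick C in porbits s | odd #|C|].

(** The default [1] is never taken: [s] preserves the chosen orbit, so the function is injective.
    Without an odd orbit, [s] is returned unchanged. *)
Definition rev_odd_orbit (T : finType) (s : {perm T}) : {perm T} :=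
  insubd (1%g : {perm T}) [ffun x => if x \in odd_orbit s then (s^-1)%g x else s x].

Lemma odd_orbit_stable (T : finType) (s : {perm T}) (x : T) :
  (s x \in odd_orbit s) = (x \in odd_orbit s).
Proof.
rewrite /odd_orbit; case: pickP => [_ /andP[/imsetP[y _ ->] _]|_] /=.
  by rewrite -!eq_porbit_mem (porbit_perm s 1).
by rewrite !inE.
Qed.

Lemma rev_odd_orbitE (T : finType) (s : {perm T}) (x : T) :
  rev_odd_orbit s x = if x \in odd_orbit s then (s^-1)%g x else s x.
Proof.
have stableV y : ((s^-1)%g y \in odd_orbit s) = (y \in odd_orbit s).
  by rewrite -[in RHS](permKV s y) odd_orbit_stable.
rewrite -pvalE /rev_odd_orbit insubdK ?ffunE //.
apply/injectiveP => {}x y; rewrite !ffunE.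
have := stableV x; have := stableV y.
have := odd_orbit_stable s x; have := odd_orbit_stable s y.
case: ifP => xC; case: ifP => yC sy sx tx ty E.
- exact: perm_inj E.
- by rewrite -E ty in sy.
- by rewrite E tx in sx.
- exact: perm_inj E.
Qed.

Lemma cycle_graph_rev (T : finType) (s : {perm T}) :
  cycle_graph (rev_odd_orbit s) =2 cycle_graph s.
Proof.
have half x y : y == rev_odd_orbit s x -> (y == s x) || (x == s y).
  move=> /eqP->; rewrite rev_odd_orbitE.
  by case: ifP => _; rewrite ?permKV eqxx ?orbT.
have half' x y : y == s x ->
    (y == rev_odd_orbit s x) || (x == rev_odd_orbit s y).
  move=> /eqP->; rewrite !rev_odd_orbitE odd_orbit_stable.
  by case: ifP => _; rewrite ?permK eqxx ?orbT.
move=> x y; apply/orP/orP => -[] H.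
- exact/orP/half.
- by apply/orP; rewrite orbC half.
- exact/orP/half'.
- by apply/orP; rewrite orbC half'.
Qed.

(** Each step of [s] is a step of [t], forwards or backwards, so it stays in one orbit of [t]. Used
    in both directions between [s] and its reversal. *)
Lemma sub_porbit (T : finType) (s t : {perm T}) (x : T) :
  (forall y z, cycle_graph s y z -> cycle_graph t y z) ->
  porbit s x \subset porbit t x.
Proof.
move=> st; apply/subsetP => _ /porbitP[k ->].
elim: k => [|k]; first by rewrite expg0 perm1 porbit_id.
rewrite expgSr permM -!eq_porbit_mem => /eqP <-.
have /st/orP[/eqP->|/eqP {2}->] : cycle_graph s ((s ^+ k)%g x) (s ((s ^+ k)%g x)).
- by rewrite /cycle_graph /= eqxx.
- by rewrite (porbit_perm t 1).
- by rewrite (porbit_perm t 1).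
Qed.

Lemma porbits_rev (T : finType) (s : {perm T}) :
  porbits (rev_odd_orbit s) = porbits s.
Proof.
apply: eq_imset => x; apply/eqP.
by rewrite eqEsubset !sub_porbit // => y z; rewrite cycle_graph_rev.
Qed.

Lemma odd_orbit_rev (T : finType) (s : {perm T}) :
  odd_orbit (rev_odd_orbit s) = odd_orbit s.
Proof. by rewrite /odd_orbit porbits_rev. Qed.

Lemma rev_odd_orbitK (T : finType) : involutive (@rev_odd_orbit T).
Proof.
move=> s; apply/permP => x.
have [xC|xC] := boolP (x \in odd_orbit s); last first.
  by rewrite !rev_odd_orbitE odd_orbit_rev (negPf xC).
rewrite rev_odd_orbitE odd_orbit_rev xC.
apply: (@perm_inj _ (rev_odd_orbit s)); rewrite permKV rev_odd_orbitE.
by rewrite odd_orbit_stable xC permK.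
Qed.

(** * Cancellation of the Leibniz terms with an odd cycle *)

Definition leibniz_term (R : comPzRingType) (T : finType) (a : T -> T -> R)
    (s : {perm T}) : R := (-1) ^+ s * \prod_x a x (s x).

Lemma odd_orbit_card (T : finType) (s : {perm T}) :
  ~~ bipartite (cycle_graph s) -> odd #|odd_orbit s|.
Proof.
move=> s_nbip; rewrite /odd_orbit; case: pickP => [_ /andP[] //|s_even].
case/negP: s_nbip; apply: bipartite_cycle_graph => x.
by have := s_even (porbit s x); rewrite imset_f // => /negbT.
Qed.

(** The sign of a permutation depends only on its set of orbits, which is kept. Each factor on the
    reversed orbit has its arguments swapped, and the number of these factors is odd. *)
Lemma leibniz_term_rev (R : comPzRingType) (T : finType) (a : T -> T -> R)
    (s : {perm T}) :
  (forall x y, a y x = - a x y) -> ~~ bipartite (cycle_graph s) ->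
  leibniz_term a (rev_odd_orbit s) = - leibniz_term a s.
Proof.
move=> a_skew s_nbip; rewrite /leibniz_term.
have -> : (rev_odd_orbit s : bool) = (s : bool) by rewrite /odd_perm porbits_rev.
rewrite -mulrN; congr (_ * _).
rewrite [LHS](bigID (mem (odd_orbit s))) [in RHS](bigID (mem (odd_orbit s))) /=.
rewrite -mulNr; congr (_ * _); last first.
  by apply: eq_bigr => x xC; rewrite rev_odd_orbitE (negPf xC).
rewrite (reindex_inj (@perm_inj _ s)) /=.
under eq_bigl do rewrite odd_orbit_stable.
under eq_bigr => x xC.
  by rewrite rev_odd_orbitE odd_orbit_stable xC permK a_skew over.
by rewrite prodrN -signr_odd odd_orbit_card // expr1 mulN1r.
Qed.

(** Reversal fixes [s] when the chosen orbit is a single point, so instead of pairing terms, the sum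
    is reindexed by this involution and found equal to its own opposite. *)
Lemma sum_leibniz_nonbipartite (R : numDomainType) (T : finType) (a : T -> T -> R) :
  (forall x y, a y x = - a x y) ->
  \sum_(s : {perm T} | ~~ bipartite (cycle_graph s)) leibniz_term a s = 0.
Proof.
move=> a_skew; set S := \sum_(s | _) _.
suff : - S == S by rewrite eqNr => /eqP.
rewrite [in X in _ == X]/S (reindex_inj (inv_inj (@rev_odd_orbitK T))) /=.
rewrite -sumrN; apply/eqP.
under [RHS]eq_bigl => s do rewrite (eq_bipartite (cycle_graph_rev s)).
by apply: eq_bigr => s s_nbip; rewrite leibniz_term_rev.
Qed.

(** * Ordered pairs of matchings and permutations with even cycles only *)

Definition matching_involutions (T : finType) (e : rel T) : {set {ffun T -> T}} :=
  [set p : {ffun T -> T} | [forall x, (p (p x) == x) && e x (p x)]].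

Lemma matching_involutionsP (T : finType) (e : rel T) (p : {ffun T -> T}) :
  reflect (involutive p /\ forall x, e x (p x)) (p \in matching_involutions e).
Proof.
rewrite inE; apply: (iffP forallP) => [pP|[pK pe] x]; last by rewrite pK eqxx pe.
by split=> x; have /andP[/eqP] := pP x.
Qed.

(** The coloring orients each cycle of the union. The default [1] is not reached for matching
    involutions of an irreflexive relation: both exchange the colors, so the function is
    injective. *)
Definition alternate (T : finType) (pq : {ffun T -> T} * {ffun T -> T}) : {perm T} :=
  insubd (1%g : {perm T})
    [ffun x => if x \in coloring (pair_graph pq.1 pq.2) then pq.1 x else pq.2 x].

(** The first matching joins each colored point to its successor, the second joins it to its
    predecessor. *)
Definition unalternate (T : finType) (s : {perm T}) :
    {ffun T -> T} * {ffun T -> T} :=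
  ([ffun x => if x \in coloring (cycle_graph s) then s x else (s^-1)%g x],
   [ffun x => if x \in coloring (cycle_graph s) then (s^-1)%g x else s x]).

Section Alternate.

Variables (T : finType) (e : rel T).
Hypotheses (e_sym : symmetric e) (e_irr : irreflexive e).

Lemma matching_involution_fix (p : {ffun T -> T}) x :
  p \in matching_involutions e -> p x != x.
Proof.
move=> /matching_involutionsP[_ /(_ x)]; apply: contraTneq => ->.
by rewrite e_irr.
Qed.

Section Pair.

Variables p q : {ffun T -> T}.
Hypotheses (pI : p \in matching_involutions e) (qI : q \in matching_involutions e).

Let pK : involutive p. Proof. by have /matching_involutionsP[] := pI. Qed.
Let qK : involutive q. Proof. by have /matching_involutionsP[] := qI. Qed.

Lemma bipartite_pair : bipartite (pair_graph p q).
Proof.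
by apply: bipartite_pair_graph => // x; exact: matching_involution_fix.
Qed.

Lemma coloring_pairl x :
  (p x \in coloring (pair_graph p q)) = (x \notin coloring (pair_graph p q)).
Proof. by apply: coloringP bipartite_pair _; rewrite /pair_graph /= eqxx. Qed.

Lemma coloring_pairr x :
  (q x \in coloring (pair_graph p q)) = (x \notin coloring (pair_graph p q)).
Proof. by apply: coloringP bipartite_pair _; rewrite /pair_graph /= eqxx orbT. Qed.

Lemma alternateE x :
  alternate (p, q) x = if x \in coloring (pair_graph p q) then p x else q x.
Proof.
rewrite -pvalE /alternate insubdK ?ffunE //.
apply/injectiveP => {}x y; rewrite !ffunE /=.
have := coloring_pairl x; have := coloring_pairl y.
have := coloring_pairr x; have := coloring_pairr y.
case: ifP => xC; case: ifP => yC qy qx py px E.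
- exact: (inv_inj pK).
- by rewrite E qy in px.
- by rewrite E py in qx.
- exact: (inv_inj qK).
Qed.

(** Edges of [p] are traversed from their colored end and edges of [q] from the other end, so none
    is lost. Hence [unalternate] sees the coloring that [alternate] used. *)
Lemma cycle_graph_alternate : cycle_graph (alternate (p, q)) =2 pair_graph p q.
Proof.
have pE x y : (y == p x) = (x == p y) by rewrite eq_sym (can2_eq pK pK).
have qE x y : (y == q x) = (x == q y) by rewrite eq_sym (can2_eq qK qK).
move=> x y; rewrite /cycle_graph /pair_graph /= !alternateE.
case: (boolP (x \in _)) => xC; case: (boolP (y \in _)) => yC.
- rewrite [x == _]eq_sym -(can2_eq pK pK) eq_sym orbb.
  suff /negPf -> : y != q x by rewrite orbF.
  by apply: contraTneq yC => ->; rewrite coloring_pairr negbK.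
- by rewrite -qE.
- by rewrite -pE orbC.
- rewrite -qE orbb; suff /negPf -> : y != p x by [].
  by apply: contraNneq yC => ->; rewrite coloring_pairl.
Qed.

Lemma bipartite_alternate : bipartite (cycle_graph (alternate (p, q))).
Proof. by rewrite (eq_bipartite cycle_graph_alternate) bipartite_pair. Qed.

Lemma alternateK : unalternate (alternate (p, q)) = (p, q).
Proof.
rewrite /unalternate (eq_coloring cycle_graph_alternate).
congr pair; apply/ffunP => x; rewrite ffunE; case: ifP => xC.
- by rewrite alternateE xC.
- apply: (@perm_inj _ (alternate (p, q))); rewrite permKV alternateE.
  by rewrite coloring_pairl xC pK.
- apply: (@perm_inj _ (alternate (p, q))); rewrite permKV alternateE.
  by rewrite coloring_pairr xC qK.
- by rewrite alternateE xC.
Qed.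

Lemma alternate_adj x : e x (alternate (p, q) x).
Proof.
rewrite alternateE; have /matching_involutionsP[_ pe] := pI.
by have /matching_involutionsP[_ qe] := qI; case: ifP.
Qed.

End Pair.

Section Unalternate.

Variable s : {perm T}.
Hypotheses (s_bip : bipartite (cycle_graph s)) (se : forall x, e x (s x)).

Lemma coloring_cycle x :
  (s x \in coloring (cycle_graph s)) = (x \notin coloring (cycle_graph s)).
Proof. by apply: coloringP s_bip _; rewrite /cycle_graph /= eqxx. Qed.

Lemma coloring_cycleV x :
  ((s^-1)%g x \in coloring (cycle_graph s)) = (x \notin coloring (cycle_graph s)).
Proof. by rewrite -[in RHS](permKV s x) coloring_cycle negbK. Qed.

(** Since [s] exchanges the colors, a step forwards from one color is undone by a step backwards
    from the other. *)
Lemma unalternate_mem :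
  ((unalternate s).1 \in matching_involutions e) &&
  ((unalternate s).2 \in matching_involutions e).
Proof.
have seV x : e x ((s^-1)%g x) by rewrite e_sym -[X in e _ X](permKV s).
apply/andP; split; apply/matching_involutionsP; split=> x; rewrite !ffunE;
  case: (boolP (x \in _)) => xC //.
all: by rewrite ?coloring_cycle ?coloring_cycleV ?xC ?(negPf xC) /= ?permK ?permKV.
Qed.

Lemma unalternateK : alternate (unalternate s) = s.
Proof.
have /andP[pI qI] := unalternate_mem.
apply/permP => x; rewrite [unalternate s]surjective_pairing alternateE //.
have /eq_coloring -> : pair_graph (unalternate s).1 (unalternate s).2 =2 cycle_graph s.
  move=> y z; rewrite /pair_graph /cycle_graph /= !ffunE.
  have -> : (y == s z) = (z == (s^-1)%g y) by rewrite eq_sym (can2_eq (permK s) (permKV s)).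
  by case: ifP => _; rewrite // orbC.
by rewrite !ffunE; case: (x \in _).
Qed.

End Unalternate.

(** Terms with an odd cycle cancel, terms using a non-edge vanish, and [alternate] parametrizes the
    remaining permutations. *)
Lemma sum_leibniz_pairs (R : numDomainType) (a : T -> T -> R) :
  (forall x y, a y x = - a x y) -> (forall x y, ~~ e x y -> a x y = 0) ->
  \sum_(s : {perm T}) leibniz_term a s =
  \sum_(pq | (pq.1 \in matching_involutions e) && (pq.2 \in matching_involutions e))
    leibniz_term a (alternate pq).
Proof.
move=> a_skew a_supp.
rewrite (bigID (fun s => bipartite (cycle_graph s))) /=.
rewrite sum_leibniz_nonbipartite // addr0.
rewrite (bigID (fun s : {perm T} => [forall x, e x (s x)])) /=.
rewrite [X in _ + X]big1 ?addr0 => [|s /andP[_]]; last first.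
  rewrite negb_forall => /existsP[x /a_supp ax0].
  by rewrite /leibniz_term (bigD1 x) //= ax0 mul0r mulr0.
rewrite (reindex_onto (@alternate T) (@unalternate T)) => [|s /andP[s_bip /forallP se]].
  apply: eq_bigl => -[p q] /=; apply/idP/idP => [/andP[/andP[s_bip /forallP se]]|].
    by move=> /eqP pqE; have := unalternate_mem s_bip se; rewrite pqE.
  move=> /andP[pI qI]; rewrite bipartite_alternate // alternateK // eqxx !andbT.
  by apply/forallP => x; exact: alternate_adj.
exact: unalternateK.
Qed.

End Alternate.

(** * Perfect matchings as involutions, and the weighted Leibniz sum *)

Definition involution_edges (T V : finType) (f : T -> V) (p : {ffun T -> T}) :
    {set {set V}} := [set [set f x; f (p x)] | x : T].

(** For a perfect matching and a bijective [f] the choice always succeeds and is unique, so the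
    default [x] is not taken. *)
Definition partner (T V : finType) (f : T -> V) (M : {set {set V}}) : {ffun T -> T} :=
  [ffun x => odflt x [pick y | [set f x; f y] \in M]].

Lemma set2_eq (V : finType) (a b c : V) : [set a; b] = [set a; c] -> b = c.
Proof.
move=> E; have := set22 a b; have := set22 a c.
by rewrite {1}E -{1}E !inE => /orP[]/eqP // -> /orP[]/eqP ->.
Qed.

Section Matchings.

Variables (T V : finType) (e : rel V) (f : T -> V) (g : V -> T).
Hypotheses (e_sym : symmetric e) (e_irr : irreflexive e).
Hypotheses (fK : cancel f g) (gK : cancel g f).

(* Matchings are handled on a copy [T] of the vertices, here the index type of
   the matrix, as fixed-point-free involutions. *)
Let e' : rel T := [rel x y | e (f x) (f y)].
Let f_inj : injective f := can_inj fK.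

Lemma mem_edges u v : ([set u; v] \in edges e) = e u v.
Proof.
apply/imsetP/idP => [[[a b] /= ab E]|uv]; last first.
  by exists (u, v); rewrite ?inE.
rewrite inE /= in ab.
have := set22 u v; rewrite E !inE => /orP[]/eqP Ev; move: E; rewrite Ev.
  by rewrite setUC => /set2_eq ->; rewrite e_sym.
by rewrite setUC [X in _ = X]setUC => /set2_eq ->.
Qed.

Lemma perfect_matching_edge M v :
  perfect_matching e M ->
  exists2 u, [set v; u] \in M & forall E, E \in M -> v \in E -> E = [set v; u].
Proof.
case/andP => /subsetP Me /forallP/(_ v)/cards1P[E ME].
have : E \in [set x in M | v \in x] by rewrite ME set11.
rewrite inE => /andP[EM vE].
have [u Eu] : exists u, E = [set v; u].
  have /imsetP[[a b] _ /= Eab] := Me _ EM.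
  move: vE; rewrite Eab !inE => /orP[]/eqP ->; first by exists b.
  by exists a; rewrite setUC.
exists u => [|E' E'M vE']; first by rewrite -Eu.
by apply/eqP; rewrite -Eu -in_set1 -ME inE E'M.
Qed.

Lemma partnerE M x y : perfect_matching e M ->
  ([set f x; f y] \in M) = (y == partner f M x).
Proof.
move=> /(@perfect_matching_edge M (f x))[u uM uniq_u]; rewrite ffunE.
have ME z : ([set f x; f z] \in M) = (z == g u).
  apply/idP/eqP => [/uniq_u|->]; last by rewrite gK.
  by rewrite set21 => /(_ isT)/set2_eq <-; rewrite fK.
by rewrite ME; case: pickP => [z|/(_ (g u))]; rewrite ME ?eqxx // => /eqP ->.
Qed.

Lemma partner_mem M : perfect_matching e M ->
  partner f M \in matching_involutions e'.
Proof.
move=> Mperf; apply/matching_involutionsP; split=> x.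
  by apply/eqP; rewrite eq_sym -partnerE // setUC partnerE.
rewrite /e' /= -mem_edges; have /andP[/subsetP -> //] := Mperf.
by rewrite partnerE.
Qed.

Lemma partnerK M : perfect_matching e M -> involution_edges f (partner f M) = M.
Proof.
move=> Mperf; apply/setP => E; apply/imsetP/idP => [[x _ ->]|EM].
  by rewrite partnerE.
have /andP[/subsetP/(_ E EM)/imsetP[[u v] /= uv Euv] _] := Mperf.
exists (g u) => //; rewrite gK Euv; congr [set _; _].
move: EM; rewrite Euv -{1}[u]gK -{1}[v]gK partnerE // => /eqP <-.
by rewrite gK.
Qed.

Lemma involution_edges_perfect p :
  p \in matching_involutions e' -> perfect_matching e (involution_edges f p).
Proof.
move=> /matching_involutionsP[pK pe]; apply/andP; split.
  by apply/subsetP => _ /imsetP[x _ ->]; rewrite mem_edges; exact: pe.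
apply/forallP => v; apply/cards1P; exists [set v; f (p (g v))].
apply/setP => E; rewrite !inE; apply/andP/eqP => [[/imsetP[x _ ->]]|->].
  rewrite !inE => /orP[]/eqP ->; first by rewrite fK.
  by rewrite fK pK setUC.
by rewrite set21; split=> //; apply/imsetP; exists (g v); rewrite ?gK.
Qed.

Lemma involution_edgesK p :
  p \in matching_involutions e' -> partner f (involution_edges f p) = p.
Proof.
move=> pI; apply/ffunP => x; apply/esym/eqP.
rewrite -partnerE; last exact: involution_edges_perfect.
exact: imset_f.
Qed.

Lemma sum_perfect_matchings (R : nmodType) (G : {set {set V}} -> R) :
  \sum_(M | perfect_matching e M) G M =
  \sum_(p in matching_involutions e') G (involution_edges f p).
Proof.
rewrite (reindex_onto (involution_edges f) (partner f)) => [|M]; last first.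
  exact: partnerK.
apply: eq_bigl => p; apply/andP/idP => [[Mperf /eqP <-]|pI].
  exact: partner_mem.
by rewrite involution_edges_perfect // involution_edgesK.
Qed.

(** Every edge of the matching has exactly one end in [A], which will be a color class. *)
Lemma prod_involution_edges (R : comPzRingType) (w : {set V} -> R)
    (p : {ffun T -> T}) (A : {set T}) :
  involutive p -> (forall x, (p x \in A) = (x \notin A)) ->
  \prod_(E in involution_edges f p) w E = \prod_(x in A) w [set f x; f (p x)].
Proof.
move=> pK pA.
have -> : involution_edges f p = [set [set f x; f (p x)] | x in A].
  apply/setP => E; apply/imsetP/imsetP => -[x xA ->]; last by exists x.
  have [xA'|xA'] := boolP (x \in A); first by exists x.
  by exists (p x); rewrite ?pA // pK setUC.
rewrite big_imset // => x y xA yA /= E.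
have := set21 (f x) (f (p x)); rewrite E !inE => /orP[/eqP/f_inj //|/eqP/f_inj xE].
by move: xA; rewrite xE pA yA.
Qed.

(** The permutation follows [p] on one color class and [q] on the other, and each class meets every
    edge of either matching exactly once. *)
Lemma prod_alternate (R : comPzRingType) (w : {set V} -> R) (p q : {ffun T -> T}) :
  p \in matching_involutions e' -> q \in matching_involutions e' ->
  \prod_x w [set f x; f (alternate (p, q) x)] =
  (\prod_(E in involution_edges f p) w E) * \prod_(E in involution_edges f q) w E.
Proof.
move=> pI qI; have e'_irr : irreflexive e' by move=> x; exact: e_irr.
have /matching_involutionsP[pK _] := pI; have /matching_involutionsP[qK _] := qI.
set A := coloring (pair_graph p q).
rewrite (@prod_involution_edges R w p A) //; last first.
  by move=> x; exact: (coloring_pairl e'_irr).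
rewrite (@prod_involution_edges R w q (~: A)) //; last first.
  by move=> x; rewrite !inE (coloring_pairr e'_irr).
rewrite (bigID (mem A)) /=; congr (_ * _).
  by apply: eq_bigr => x xA; rewrite (alternateE e'_irr) ?xA.
apply: eq_big => [x|x xA]; first by rewrite inE.
by rewrite (alternateE e'_irr) ?(negPf xA).
Qed.

Lemma card_matching_involutions : #|matching_involutions e'| = perfmat e.
Proof.
have E : (\sum_(M | perfect_matching e M) 1 =
          \sum_(p in matching_involutions e') 1)%N.
  exact: (sum_perfect_matchings (fun=> 1%N)).
by rewrite -sum1_card -E /perfmat -sum1_card; apply: eq_bigl => M; rewrite inE.
Qed.

(* Every pair of matchings contributes at most 1 to the sum, and there are
   [perfmat e ^ 2] pairs, so a pfaffian orientation forces each contribution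
   to be exactly 1. *)
Lemma sum_leibniz_weighted (R : numDomainType) (s : T -> T -> int)
    (w : {set V} -> R) :
  (forall x y, s y x = - s x y) -> (forall x y, ~~ e' x y -> s x y = 0) ->
  (forall x y, `|s x y| <= 1) ->
  \sum_(t : {perm T}) leibniz_term s t = (perfmat e)%:Z ^+ 2 ->
  \sum_(t : {perm T})
     leibniz_term (fun x y => (s x y)%:~R * w [set f x; f y]) t =
  (\sum_(M | perfect_matching e M) \prod_(E in M) w E) ^+ 2.
Proof.
move=> s_skew s_supp s_le1 s_sum.
have e'_sym : symmetric e' by move=> x y; exact: e_sym.
have e'_irr : irreflexive e' by move=> x; exact: e_irr.
pose I := matching_involutions e'.
have term_le1 t : leibniz_term s t <= 1.
  rewrite (le_trans (ler_norm _)) // normrM normrX normrN1 expr1n mul1r.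
  by rewrite normr_prod prodr_ile1 // => x _; rewrite normr_ge0 s_le1.
have term1 pq : (pq.1 \in I) && (pq.2 \in I) -> leibniz_term s (alternate pq) = 1.
  move=> pqI; apply/esym/eqP; rewrite -subr_eq0; apply/eqP.
  move: pq pqI; apply: psumr_eq0P => [pq _|]; first by rewrite subr_ge0.
  rewrite sumrB -(sum_leibniz_pairs e'_sym e'_irr) // s_sum.
  rewrite -(pair_big (mem I) (mem I) (fun _ _ => 1)) /= sumr_const.
  rewrite sumr_const card_matching_involutions -mulrnA mulnn natrX natz.
  by rewrite subrr.
rewrite (sum_leibniz_pairs e'_sym e'_irr); first last.
- by move=> x y /s_supp ->; rewrite mul0r.
- by move=> x y; rewrite s_skew rmorphN mulNr setUC.
rewrite sum_perfect_matchings expr2 big_distrlr pair_big /=.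
apply: eq_bigr => -[p q] /= pqI; have /andP[pI qI] := pqI.
rewrite -prod_alternate // /leibniz_term big_split /= mulrA -[RHS]mul1r.
(* With the weights split off, what remains is the image in [R] of the unweighted term, which is
   1. *)
congr (_ * _); rewrite -[RHS]/(1%:~R) -(term1 (p, q) pqI) /leibniz_term.
by rewrite rmorphM rmorphXn rmorphN1 rmorph_prod.
Qed.

End Matchings.

(** * The bound on weighted and unweighted matching counts *)

Lemma powR_prod (R : realType) (I : finType) (F : I -> R) (r : R) :
  (forall i, 0 <= F i) -> (\prod_i F i) `^ r = \prod_i F i `^ r.
Proof.
move=> F_ge0; suff [] : 0 <= \prod_i F i /\ (\prod_i F i) `^ r = \prod_i F i `^ r by [].
apply: (big_ind2 (fun x y => 0 <= x /\ x `^ r = y)) => //.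
- by rewrite ler01 powR1.
- by move=> x _ y _ [x0 <-] [y0 <-]; rewrite mulr_ge0 ?powRM.
Qed.

Lemma wperfmat_le (R : realType) (V : finType) (e : rel V) (o : rel V)
    (w : {set V} -> R) :
  symmetric e -> irreflexive e -> pfaffian_orientation e o ->
  (forall x, x \in edges e -> 0 <= w x) ->
  wperfmat e w <= \prod_(v : V) (wdegree2 e w v `^ (4%:R^-1)).
Proof.
move=> e_sym e_irr [[oe oP] det_o] w_ge0.
pose S := skew_adjacency o; pose f : 'I_#|V| -> V := enum_val.
have o_irr u v : o u v -> o v u = false.
  by move=> ouv; have := oP u v (oe u v ouv); rewrite ouv => /negbTE.
have S_skew i j : S j i = - S i j.
  rewrite !mxE; case: ifP => [/o_irr -> //|_]; case: ifP => _; rewrite ?opprK ?oppr0 //.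
have S_supp i j : ~~ e (f i) (f j) -> S i j = 0.
  rewrite !mxE => nij; case: ifP => [/oe|_]; first by rewrite (negPf nij).
  by case: ifP => // /oe; rewrite e_sym (negPf nij).
(* Exactly one direction of each edge is chosen, so squaring the entries forgets the orientation and
   the row sums become degrees. *)
have S_abs i j : `|S i j| = (e (f i) (f j) : nat)%:Z.
  have [eij|/S_supp ->] := boolP (e (f i) (f j)); last by rewrite normr0.
  rewrite !mxE; have := oP _ _ eij.
  by case: ifP => _ //; case: ifP => _ //=; rewrite ?normrN normr1.
pose A : 'M[R]_#|V| := \matrix_(i, j) ((S i j)%:~R * w [set f i; f j]).
have detA : \det A = wperfmat e w ^+ 2.
  rewrite /wperfmat.
  rewrite -(sum_leibniz_weighted e_sym e_irr (@enum_valK V) (@enum_rankK V) _ S_skew) //.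
  + apply: eq_bigr => t _; rewrite /leibniz_term; congr (_ * _).
    by apply: eq_bigr => i _; rewrite mxE.
  + by move=> i j; rewrite S_abs; case: (e _ _).
have W_ge0 : 0 <= wperfmat e w.
  apply: sumr_ge0 => M /andP[/subsetP Me _]; apply: prodr_ge0 => E /Me.
  exact: w_ge0.
have D_ge0 v : 0 <= wdegree2 e w v by apply: sumr_ge0 => u _; rewrite sqr_ge0.
(* The fourth power arises because the determinant is already a square and Hadamard's inequality
   bounds its square. *)
have W4 : wperfmat e w ^+ 4 <= \prod_v wdegree2 e w v.
  rewrite (exprM _ 2 2) -detA (le_trans (hadamard_sqr A)) //.
  rewrite [leRHS](reindex _ (onW_bij _ (@enum_val_bij V))) /=.
  apply: ler_prod => i _; apply/andP; split; first by apply: sumr_ge0 => j _; rewrite sqr_ge0.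
  rewrite /wdegree2 [leRHS]big_mkcond.
  rewrite [leRHS](reindex _ (onW_bij _ (@enum_val_bij V))) /=.
  apply: ler_sum => j _; rewrite mxE exprMn -rmorphXn -real_normK ?num_real //.
  rewrite S_abs e_sym setUC; case: (e _ _); rewrite ?mul1r //.
  by rewrite expr0n mul0r.
rewrite -powR_prod //.
have -> : wperfmat e w = (wperfmat e w ^+ 4) `^ 4%:R^-1.
  by rewrite -powR_mulrn // -powRrM divff ?powRr1 // pnatr_eq0.
by rewrite ge0_ler_powR // ?invr_ge0 ?ler0n // nnegrE ?exprn_ge0 // prodr_ge0.
Qed.

Theorem theorem3p1 (R : realType) (V : finType) (e : rel V)
    (e_sym : symmetric e) (e_irr : irreflexive e)
    (n_even : ~~ odd #|V|)
    (e_pfaffian : exists o : rel V, pfaffian_orientation e o) :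
  (forall w : {set V} -> R,
     (forall x : {set V}, x \in edges e -> 0 <= w x) ->
     wperfmat e w <= \prod_(v : V) (wdegree2 e w v `^ (4%:R^-1))) /\
  (perfmat e)%:R <= \prod_(v : V) ((degree e v)%:R `^ (4%:R^-1)) :> R.
Proof.
have [o o_pfaffian] := e_pfaffian.
split=> [w w_ge0|]; first exact: wperfmat_le o_pfaffian w_ge0.
(* Unit weights turn the weighted count into [perfmat] and [wdegree2] into [degree]. *)
have := @wperfmat_le R V e o (fun=> 1) e_sym e_irr o_pfaffian (fun _ _ => ler01).
have -> : wperfmat e (fun=> 1 : R) = (perfmat e)%:R.
  rewrite /wperfmat (eq_bigr (fun=> 1)) => [|M _]; last by rewrite big1.
  by rewrite sumr_const /perfmat cardsE.
rewrite (eq_bigr (fun v => (degree e v)%:R `^ 4%:R^-1)) // => v _.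
congr (_ `^ _); rewrite /wdegree2 (eq_bigr (fun=> 1)) => [|u _]; last by rewrite expr1n.
rewrite sumr_const /degree cardsE; congr (_ *+ _).
Qed.
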